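(* Let $\{\xi_1,\xi_2\}$ and $\{\eta_1,\eta_2\}$ be orthonormal bases of $\mathbb{C}^2$, and let $T:M_2(\mathbb{C})\to M_2(\mathbb{C})$ be a unital positive linear map with $T(|\xi_1\rangle\langle\xi_1|)\eta_1=0$, whose Choi matrix in the basis $\{\xi_i\otimes\eta_k\}$ (ordered $\xi_1\otimes\eta_1,\ \xi_1\otimes\eta_2,\ \xi_2\otimes\eta_1,\ \xi_2\otimes\eta_2$) is $$H_T=\begin{pmatrix}0&0&0&y\\0&\lambda&\overline{z}&t\\0&z&1&0\\\overline{y}&\overline{t}&0&1-\lambda\end{pmatrix},\qquad \lambda\in[0,1],\ y,z,t\in\mathbb{C}.$$ Assume that $\lambda,y,z$ are all nonzero, that $T$ is extremal, and that $|y|+|z|=\lambda^{1/2}$. Choose $y_1\in\mathbb{C}$ with $y_1^2=y$, put $t_1=t_2=t/2$, let $c\in\mathbb{C}$ be determined by $$\overline{y_1}\,\lambda^{-1/4}\,t_1=y_1\,\lambda^{1/4}\,\overline{c},$$ and put $$a_1=|y|\lambda^{-1/2},\quad \lambda_1=|y|\lambda^{1/2},\quad b_1=|z|\lambda^{-1/2}(1-\lambda),$$ $$a_2=|z|\lambda^{-1/2},\quad \lambda_2=|z|\lambda^{1/2},\quad b_2=|y|\lambda^{-1/2}(1-\lambda).$$ Let $T_1,T_2:M_2(\mathbb{C})\to M_2(\mathbb{C})$ be the linear maps with Choi matrices $$H_{T_1}=\begin{pmatrix}0&0&0&y\\0&\lambda_1&0&t_1\\0&0&a_1&c\\\overline{y}&\overline{t_1}&\overline{c}&b_1\end{pmatrix},\qquad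 H_{T_2}=\begin{pmatrix}0&0&0&0\\0&\lambda_2&\overline{z}&t_2\\0&z&a_2&-c\\0&\overline{t_2}&-\overline{c}&b_2\end{pmatrix}.$$ Then $T=T_1+T_2$, the map $T_2$ is completely positive, the map $T_1$ is completely copositive, and this is the unique decomposition of $T$ as a sum of a completely copositive map and a completely positive map.
   Context: A linear map $T:M_2(\mathbb{C})\to M_2(\mathbb{C})$ is positive if it maps positive semidefinite matrices to positive semidefinite matrices, and unital if $T(\mathbb{I})=\mathbb{I}$. A map is completely copositive (co-CP) if it is the composition of the transposition with a completely positive map. ''Extremal'' means that $T$ is an extreme point of the convex set of unital positive linear maps $M_2(\mathbb{C})\to M_2(\mathbb{C})$. With $e_{ij}=|\xi_i\rangle\langle\xi_j|$, the Choi matrix of $T$ is $H_T=\sum_{i,j}e_{ij}\otimes T(e_{ij})$, written in the basis $\{\xi_i\otimes\eta_k\}$; thus its $(i,j)$ block of size $2\times2$ is the matrix of $T(e_{ij})$ in the basis $\{\eta_1,\eta_2\}$. Every unital positive map $T$ with $T(|\xi_1\rangle\langle\xi_1|)\eta_1=0$ has a Choi matrix of the displayed form $H_T$. The maps $T_1$ and $T_2$ are not required to be unital. *)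

(* Defs.v *)
From HB Require Import structures.
From mathcomp Require Export all_boot all_order all_algebra.
From mathcomp Require Export reals.
From mathcomp.real_closed Require Export complex mxtens.

Set Implicit Arguments.
Unset Strict Implicit.
Unset Printing Implicit Defensive.

Import Order.TTheory GRing.Theory Num.Theory.
Local Open Scope ring_scope.
Local Open Scope sesquilinear_scope.

Section PositiveMaps.
Variable C : numClosedFieldType.

(* In the partial order of C, [0 <= x] says that x is real and nonnegative, so
   the quadratic form is real-valued and A is automatically Hermitian. *)
Definition psdmx n (A : 'M[C]_n) : Prop :=
  forall v : 'cV[C]_n, 0 <= (v^t* *m A *m v) 0 0.

Definition positive_map n (T : 'End('M[C]_n)) : Prop :=
  forall A, psdmx A -> psdmx (T A).

Definition unital_map n (T : 'End('M[C]_n)) : Prop := T 1%:M = 1%:M.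

(* id_k (x) T on M_k (x) M_n, where M_k (x) M_n is identified with M_(k * n)
   through the Kronecker product [*t]: T is applied to every n x n block. *)
Definition ampliation n (T : 'End('M[C]_n)) k (A : 'M[C]_(k * n)) :
    'M[C]_(k * n) :=
  \sum_(i < k) \sum_(j < k)
    delta_mx i j *t
      T (\matrix_(p < n, q < n) A (mxtens_index (i, p)) (mxtens_index (j, q))).

Lemma ampliation_tens n (T : 'End('M[C]_n)) k (E : 'M[C]_k) (X : 'M[C]_n) :
  ampliation T (E *t X) = E *t T X.
Proof.
apply/matrixP=> r s; case: (mxtens_indexP r) => i p.
case: (mxtens_indexP s) => j q; rewrite /ampliation summxE.
rewrite (bigD1 i) //= summxE (bigD1 j) //= !mxE !mxtens_indexK /= !eqxx mul1r.
rewrite !big1 ?addr0 => [|i' i'i|j' j'j].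
- have -> : (\matrix_(p0, q0) (E *t X) (mxtens_index (i, p0))
      (mxtens_index (j, q0))) = E i j *: X.
    by apply/matrixP=> a b; rewrite !mxE !mxtens_indexK.
  by rewrite linearZ mxE.
- rewrite summxE big1 // => j' _.
  by rewrite !mxE !mxtens_indexK /= eq_sym (negPf i'i) mul0r.
- by rewrite !mxE !mxtens_indexK /= (eq_sym j) (negPf j'j) andbF mul0r.
Qed.

Definition completely_positive n (T : 'End('M[C]_n)) : Prop :=
  forall k (A : 'M[C]_(k * n)), psdmx A -> psdmx (ampliation T A).

Definition transposition n : 'End('M[C]_n) := linfun (@trmx C n n).

(* Composing with the transposition on the other side gives the same class,
   since conjugating a map by the transposition preserves complete
   positivity. *)
Definition completely_copositive n (T : 'End('M[C]_n)) : Prop :=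
  exists2 S : 'End('M[C]_n),
    completely_positive S & T = (transposition n \o S)%VF.

Definition extreme_point (V : lmodType C) (K : V -> Prop) (x : V) : Prop :=
  K x /\
  forall (u v : V) (s : C), K u -> K v -> 0 < s < 1 ->
    x = s *: u + (1 - s) *: v -> u = x /\ v = x.

Definition extremal_map n (T : 'End('M[C]_n)) : Prop :=
  extreme_point (fun S : 'End('M[C]_n) => unital_map S /\ positive_map S) T.

Definition ketbra n (u v : 'cV[C]_n) : 'M[C]_n := u *m v^t*.

(* An orthonormal family of n vectors in C^n is an orthonormal basis. *)
Definition orthonormal_basis n (xi : 'I_n -> 'cV[C]_n) : Prop :=
  forall i j, ((xi i)^t* *m xi j) 0 0 = (i == j)%:R.

Definition basis_mx n (xi : 'I_n -> 'cV[C]_n) : 'M[C]_n :=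
  \matrix_(k, i) xi i k 0.

Definition choi_op n (xi : 'I_n -> 'cV[C]_n) (T : 'End('M[C]_n)) :
    'M[C]_(n * n) :=
  \sum_(i < n) \sum_(j < n) ketbra (xi i) (xi j) *t T (ketbra (xi i) (xi j)).

(* Matrix of [choi_op xi T] in the basis (xi_i (x) eta_k), with (i, k) in
   lexicographic order: the columns of [basis_mx xi *t basis_mx eta] are the
   vectors xi_i (x) eta_k. *)
Definition choi_mx n (xi eta : 'I_n -> 'cV[C]_n) (T : 'End('M[C]_n)) :
    'M[C]_(n * n) :=
  (basis_mx xi *t basis_mx eta)^t* *m choi_op xi T
    *m (basis_mx xi *t basis_mx eta).

(* The matrix with the given list of rows; 2 * 2 is the type in which the
   Choi matrix of a map on M_2 lives. *)
Definition mx_of_rows (rows : seq (seq C)) : 'M[C]_(2 * 2) :=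
  \matrix_(i, j) (nth [::] rows i)`_j.

End PositiveMaps.

(* Main.v *)
Require Import Defs.
From mathcomp Require Import all_boot all_order all_algebra.
From mathcomp Require Import reals.
From mathcomp.real_closed Require Import complex mxtens.
From mathcomp Require Import ring.

(* Choi matrices turn complete positivity of a summand into positivity of a 4x4
   matrix, and complete copositivity into positivity of its partial transpose.

   Positivity of T alone forces e t to be purely imaginary for the phase e that
   aligns e y with e^* z, with |t|^2 <= 4 |y| |z| (1 - lambda). When equality
   holds, the two candidate matrices have rank one, so T = T1 + T2 is a
   decomposition. It follows that both ends of the segment of admissible t
   are parameters of unital positive maps, so extremality puts t at an end and
   forces equality.

   In any decomposition the vanishing first diagonal entry places y in the
   copositive part and z in the positive one. The principal minors and
   |y| + |z| = sqrt lambda are then the equality case of Cauchy-Schwarz, which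
   fixes all diagonal entries but the last and makes two 2x2 minors singular.
   Singularity gives the two shares of t the same modulus; the minors involving
   the last diagonal entry bound that modulus by |t| / 2, so both shares are
   t / 2. *)

Set Implicit Arguments.
Unset Strict Implicit.
Unset Printing Implicit Defensive.

Import Order.TTheory GRing.Theory Num.Theory.
Local Open Scope ring_scope.
Local Open Scope sesquilinear_scope.

(** * Positive semidefinite matrices and their 2x2 minors *)

Section PsdMatrices.
Variable C : numClosedFieldType.

Lemma adjmxM m n p (A : 'M[C]_(m, n)) (B : 'M_(n, p)) :
  (A *m B)^t* = B^t* *m A^t*.
Proof. by rewrite trmx_mul map_mxM. Qed.

Lemma adjmxD m n (A B : 'M[C]_(m, n)) : (A + B)^t* = A^t* + B^t*.
Proof. by apply/matrixP=> i j; rewrite !mxE rmorphD. Qed.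

Lemma adjmx_tens m n p q (A : 'M[C]_(m, n)) (B : 'M[C]_(p, q)) :
  (A *t B)^t* = A^t* *t B^t*.
Proof. by rewrite trmx_tens map_mxT. Qed.

Lemma psdmx_congr m n (B : 'M[C]_(m, n)) (A : 'M_m) :
  psdmx A -> psdmx (B^t* *m A *m B).
Proof. by move=> psdA v; have := psdA (B *m v); rewrite adjmxM !mulmxA. Qed.

Lemma psdmxD n (A B : 'M[C]_n) : psdmx A -> psdmx B -> psdmx (A + B).
Proof.
by move=> psdA psdB v; rewrite mulmxDr mulmxDl mxE addr_ge0 ?psdA ?psdB.
Qed.

Lemma adj_formE n (A : 'M[C]_n) (v w : 'cV_n) :
  (v^t* *m A *m w) 0 0 = \sum_j \sum_i (v i 0)^* * A i j * w j 0.
Proof.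
rewrite mxE; apply: eq_bigr => j _; rewrite mxE mulr_suml.
by apply: eq_bigr => i _; rewrite !mxE.
Qed.

Lemma psdmx_outer n (v : 'cV[C]_n) : psdmx (v *m v^t*).
Proof.
move=> w; rewrite mulmxA -mulmxA mxE big_ord1.
have -> : w^t* *m v = (v^t* *m w)^t* by rewrite adjmxM trmxCK.
by rewrite !mxE mulrC mul_conjC_ge0.
Qed.

(** The form of [A^T] at [v] is the form of [A] at the entrywise conjugate of [v]. *)
Lemma psdmx_trmx n (A : 'M[C]_n) : psdmx A -> psdmx A^T.
Proof.
move=> psdA v; have := psdA (map_mx Num.conj v).
suff -> : ((map_mx Num.conj v)^t* *m A *m map_mx Num.conj v) 0 0 =
          (v^t* *m A^T *m v) 0 0 by [].
rewrite !adj_formE exchange_big; apply: eq_bigr => i _; apply: eq_bigr => j _.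
by rewrite !mxE conjCK; ring.
Qed.

Lemma adj_form2 n (A : 'M[C]_n) (i j : 'I_n) (a b : C) : 
  let v : 'cV_n := a *: delta_mx i 0 + b *: delta_mx j 0 in
  (v^t* *m A *m v) 0 0 =
  a^* * a * A i i + a^* * b * A i j + b^* * a * A j i + b^* * b * A j j.
Proof.
have E k l (x y : C) :
    (((x *: delta_mx k 0 : 'cV_n)^t* *m A) *m (y *: delta_mx l 0 : 'cV_n)) 0 0 =
      x^* * y * A k l.
  rewrite -scalemxAr linearZ /= map_mxZ -!scalemxAl mxE mxE mulrCA mulrA.
  by rewrite trmx_delta map_delta_mx -rowE -colE !mxE.
move=> v; rewrite adjmxD !(mulmxDl, mulmxDr).
by rewrite mxE [X in X + _]mxE [X in _ + X]mxE !E addrACA !addrA.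
Qed.

Lemma psdmx_diag_ge0 n (A : 'M[C]_n) i : psdmx A -> 0 <= A i i.
Proof.
move=> psdA; have := psdA (1 *: delta_mx i 0 + 0 *: delta_mx i 0).
by rewrite adj_form2 conjC0 conjC1 !(mul0r, mulr0, mul1r, addr0).
Qed.

(** Polarization: reality of the form at [e_i + e_j] makes [A i j + A j i] real, and reality at
    [e_i + 'i e_j] makes [A i j - A j i] imaginary. *)
Lemma psdmx_herm n (A : 'M[C]_n) i j : psdmx A -> A j i = (A i j)^*.
Proof.
move=> psdA.
have realA k : (A k k)^* = A k k.
  by apply: conj_Creal; rewrite realE psdmx_diag_ge0.
have realF a b :=
  conj_Creal (ger0_real (psdA (a *: delta_mx i 0 + b *: delta_mx j 0))).
have := realF 1 1; have := realF 1 'i; rewrite !adj_form2 conjC1 !conjCi.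
rewrite !rmorphD !rmorphM !rmorphN /= !conjC1 !conjCi !realA.
rewrite !mul1r !mulr1 opprK.
set x := A i j; set y := A j i; move=> h1 h2.
have {h2} h2 : x^* + y^* = x + y.
  apply: (addrI (A i i)); apply: (addIr (A j j)); move: h2; rewrite !addrA //.
have {h1} h1 : y^* - x^* = x - y.
  apply: (mulfI (neq0Ci C)); apply/eqP; rewrite -subr_eq0; apply/eqP.
  by move/eqP: h1; rewrite -subr_eq0 => /eqP <-; ring.
have two0 : (2 : C) != 0 by rewrite pnatr_eq0.
apply: (mulfI two0).
have -> : 2 * y = (x + y) - (x - y) by ring.
by rewrite -h1 -h2; ring.
Qed.

Lemma psdmx_adj n (A : 'M[C]_n) : psdmx A -> A^t* = A.
Proof. by move=> psdA; apply/matrixP=> i j; rewrite !mxE -psdmx_herm. Qed.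

Lemma adjmx_sq_eq0 n (v : 'cV[C]_n) : (v^t* *m v) 0 0 = 0 -> v = 0.
Proof.
rewrite mxE => /eqP; rewrite psumr_eq0 => [/allP v0|i _]; last first.
  by rewrite !mxE mulrC mul_conjC_ge0.
apply/matrixP=> i j; rewrite ord1; have := v0 i (mem_index_enum i).
by rewrite !mxE mulrC mul_conjC_eq0 => /eqP.
Qed.

(** Along [v + s *: w] with [v = A *m w] and [s] real, the form is affine in [s] with slope twice
    the squared norm of [A *m w], so it stays nonnegative only if that norm vanishes. *)
Lemma psdmx_null n (A : 'M[C]_n) (w : 'cV_n) :
  psdmx A -> (w^t* *m A *m w) 0 0 = 0 -> A *m w = 0.
Proof.
move=> psdA w0; apply: adjmx_sq_eq0; set N := (_ *m _) 0 0.
pose v := A *m w; pose F := (v^t* *m A *m v) 0 0.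
have F_ge0 : 0 <= F by apply: psdA.
have N_ge0 : 0 <= N.
  by rewrite /N mxE sumr_ge0 // => i _; rewrite !mxE mulrC mul_conjC_ge0.
case: (eqVneq N 0) => // N0.
(* The value of [s] at which the form equals -1. *)
pose s : C := - (F + 1) / (2 * N).
have sr : s^* = s.
  have [Fr Nr] := (ger0_real F_ge0, ger0_real N_ge0).
  by apply: conj_Creal; rewrite rpredM ?rpredN ?rpredV ?rpredM ?rpredD ?rpred1.
have := psdA (v + s *: w).
have adjs : (s *: w)^t* = s *: w^t*.
  by apply/matrixP=> i j; rewrite !mxE rmorphM /= sr.
rewrite adjmxD adjs !(mulmxDl, mulmxDr) -?scalemxAl -?scalemxAr -?scalemxAl.
have E1 : (v^t* *m A *m w) 0 0 = N by rewrite -mulmxA.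
have E2 : (w^t* *m A *m v) 0 0 = N by rewrite -[in LHS](psdmx_adj psdA) -adjmxM.
rewrite mxE [X in X + _]mxE [X in _ + X]mxE -/F.
rewrite [(s *: (v^t* *m A *m w)) 0 0]mxE [(s *: (w^t* *m A *m v)) 0 0]mxE E1 E2.
rewrite [(s *: (s *: (w^t* *m A *m w))) 0 0]mxE [(s *: (w^t* *m A *m w)) 0 0]mxE.
rewrite w0 !mulr0 addr0.
have -> : F + s * N + s * N = -1 by rewrite /s; field.
by rewrite oppr_ge0 ler10.
Qed.

Lemma psdmx_null2 n (A : 'M[C]_n) i j (a b : C) k : psdmx A ->
  a^* * a * A i i + a^* * b * A i j + b^* * a * A j i + b^* * b * A j j = 0 ->
  a * A k i + b * A k j = 0.
Proof.
move=> psdA; rewrite -adj_form2 => /(psdmx_null psdA)/matrixP/(_ k 0).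
rewrite mulmxDr -!scalemxAr -!colE !mxE //.
Qed.

Lemma psdmx_diag0 n (A : 'M[C]_n) i k : psdmx A -> A i i = 0 -> A k i = 0.
Proof.
move=> psdA Aii.
have := @psdmx_null2 _ A i i 1 0 k psdA; rewrite Aii !(mul0r, mulr0, addr0) mul1r.
by apply.
Qed.

Lemma psdmx_minor n (A : 'M[C]_n) i j :
  psdmx A -> `|A i j| ^+ 2 <= A i i * A j j.
Proof.
move=> psdA; have Ajj := psdmx_diag_ge0 j psdA.
have [Aii|/eqP Aii] := eqVneq (A i i) 0.
  rewrite Aii mul0r (psdmx_herm _ _ psdA) psdmx_diag0 //.
  by rewrite conjC0 normr0 expr0n.
(* The form at this vector is [A i i] times the minor. *)
have := psdA (- A i j *: delta_mx i 0 + A i i *: delta_mx j 0).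
have Aii_gt0 : 0 < A i i by rewrite lt_def psdmx_diag_ge0 // andbT; apply/eqP.
rewrite adj_form2 (psdmx_herm i j psdA) rmorphN /=.
have -> : (A i i)^* = A i i by rewrite -psdmx_herm.
move=> form_ge0; rewrite normCK -subr_ge0 -(pmulr_rge0 _ Aii_gt0).
apply: le_trans form_ge0 _; rewrite le_eqVlt; apply/orP; left; apply/eqP.
by ring.
Qed.

(** A singular minor makes the form vanish at [- A i j *: e_i + A i i *: e_j], which therefore lies
    in the kernel of [A]; the relation is row [k] of this. *)
Lemma psdmx_rank1 n (A : 'M[C]_n) i j k : psdmx A ->
  A i i * A j j = `|A i j| ^+ 2 -> A k i * A i j = A k j * A i i.
Proof.
move=> psdA E.
have := @psdmx_null2 _ A i j (- A i j) (A i i) k psdA.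
rewrite rmorphN /=; have -> : (A i i)^* = A i i by rewrite -psdmx_herm.
move=> H; apply/eqP; rewrite -subr_eq0 -oppr_eq0; apply/eqP.
rewrite -[RHS]H; first by ring.
rewrite (psdmx_herm i j psdA) -[RHS](mulr0 (A i i)).
have <- : A i i * A j j - A i j * (A i j)^* = 0 by rewrite -normCK E subrr.
by ring.
Qed.

End PsdMatrices.

(** * Complete positivity, transposition and Choi matrices *)

Section CompletePositivity.
Variables (C : numClosedFieldType) (n : nat).
Implicit Types (M A X : 'M[C]_n) (S T : 'End('M[C]_n)).
Implicit Types xi eta : 'I_n -> 'cV[C]_n.

(** The completely positive map with the single Kraus operator [M]. *)
Definition conj_map M : 'End('M[C]_n) :=
  linfun (mulmxr (M^t*) \o mulmx M : 'M_n -> 'M_n).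

Lemma conj_mapE M A : conj_map M A = M *m A *m M^t*.
Proof. by rewrite lfunE. Qed.

Lemma transpositionE A : transposition C n A = A^T.
Proof. by rewrite lfunE. Qed.

Lemma tens_block k (A : 'M[C]_(k * n)) :
  A = \sum_(i < k) \sum_(j < k) delta_mx i j *t
      (\matrix_(p < n, q < n) A (mxtens_index (i, p)) (mxtens_index (j, q))).
Proof.
apply/matrixP=> r s; case: (mxtens_indexP r) => i p.
case: (mxtens_indexP s) => j q; rewrite summxE.
rewrite (bigD1 i) //= summxE (bigD1 j) //= !mxE !mxtens_indexK /= !eqxx mul1r.
rewrite !big1 ?addr0 => [|i' i'i|j' j'j] //.
- rewrite summxE big1 // => j' _.
  by rewrite !mxE !mxtens_indexK /= eq_sym (negPf i'i) mul0r.
- by rewrite !mxE !mxtens_indexK /= (eq_sym j) (negPf j'j) andbF mul0r.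
Qed.

Lemma ampliation_conj_map M k (A : 'M[C]_(k * n)) :
  ampliation (conj_map M) A = (1%:M *t M) *m A *m (1%:M *t M)^t*.
Proof.
rewrite [in RHS](tens_block A) mulmx_sumr mulmx_suml; apply: eq_bigr => i _.
rewrite mulmx_sumr mulmx_suml; apply: eq_bigr => j _.
rewrite adjmx_tens !tensmx_mul conj_mapE mul1mx trmx1 map_mx1 mulmx1.
by [].
Qed.

Lemma conj_map_cp M : completely_positive (conj_map M).
Proof.
move=> k A psdA; rewrite ampliation_conj_map.
by rewrite -{1}[1%:M *t M]trmxCK; apply: psdmx_congr.
Qed.

Lemma conj_map_positive M : positive_map (conj_map M).
Proof.
by move=> A psdA; rewrite conj_mapE -{1}[M]trmxCK; apply: psdmx_congr.
Qed.

Lemma transposition_positive : positive_map (transposition C n).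
Proof. by move=> A psdA; rewrite transpositionE; apply: psdmx_trmx. Qed.

Lemma ampliation_sum S k I (r : seq I) (F : I -> 'M[C]_(k * n)) :
  ampliation S (\sum_(l <- r) F l) = \sum_(l <- r) ampliation S (F l).
Proof.
rewrite /ampliation.
rewrite (@exchange_big _ _ _ _ _ r); apply: eq_bigr => i _.
rewrite (@exchange_big _ _ _ _ _ r); apply: eq_bigr => j _.
apply/matrixP=> a b; case: (mxtens_indexP a) => i1 p.
case: (mxtens_indexP b) => j1 q.
rewrite summxE tensmxE.
under [RHS]eq_bigr do rewrite tensmxE.
rewrite -mulr_sumr; congr (_ * _).
rewrite -summxE -linear_sum; congr ((S _) p q).
apply/matrixP=> a' b'; rewrite !(mxE, summxE).
by apply: eq_bigr => l _; rewrite mxE.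
Qed.

(** For orthonormal [xi] this is the unnormalised projection onto a maximally entangled vector; the
    ampliation of a map sends it to the Choi operator of that map. *)
Lemma ketbra_tens_sum xi :
  \sum_i \sum_j ketbra (xi i) (xi j) *t ketbra (xi i) (xi j) =
  (\sum_i xi i *t xi i) *m (\sum_i xi i *t xi i)^t* :> 'M_(n * n).
Proof.
have -> : (\sum_i xi i *t xi i)^t* = \sum_i (xi i)^t* *t (xi i)^t*.
  rewrite raddf_sum /=; apply/matrixP => a b.
  rewrite !(mxE, summxE) rmorph_sum; apply: eq_bigr => i _.
  by rewrite -adjmx_tens !mxE.
rewrite mulmx_suml; apply: eq_bigr => i _.
by rewrite mulmx_sumr; apply: eq_bigr => j _; rewrite tensmx_mul.
Qed.

Lemma choi_op_psd xi S : completely_positive S -> psdmx (choi_op xi S).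
Proof.
move=> cpS; have := cpS n _ (psdmx_outer (\sum_i xi i *t xi i)).
rewrite -ketbra_tens_sum ampliation_sum.
congr psdmx; apply: eq_bigr => i _; rewrite ampliation_sum.
by apply: eq_bigr => j _; rewrite ampliation_tens.
Qed.

Lemma choi_mx_psd xi eta S : completely_positive S -> psdmx (choi_mx xi eta S).
Proof. by move=> cpS; apply: psdmx_congr; apply: choi_op_psd. Qed.

Lemma basis_mx_form eta X p q :
  ((basis_mx eta)^t* *m X *m basis_mx eta) p q = ((eta p)^t* *m X *m eta q) 0 0.
Proof.
rewrite adj_formE mxE; apply: eq_bigr => b _; rewrite !mxE mulr_suml.
by apply: eq_bigr => a _; rewrite !mxE.
Qed.

Lemma basis_mx_adj xi :
  orthonormal_basis xi -> (basis_mx xi)^t* *m basis_mx xi = 1%:M.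
Proof.
move=> onb; apply/matrixP=> i j; rewrite [RHS]mxE -onb !mxE.
by apply: eq_bigr => k _; rewrite !mxE.
Qed.

Lemma ketbra_basis_mx xi i j : ketbra (xi i) (xi j) =
  basis_mx xi *m delta_mx i j *m (basis_mx xi)^t*.
Proof.
have -> : delta_mx i j = delta_mx i (0 : 'I_1) *m delta_mx 0 j :> 'M[C]_n.
  by rewrite mul_delta_mx.
rewrite mulmxA -mulmxA -rowE -colE /ketbra.
by congr (_ *m _); apply/matrixP=> a b; rewrite !mxE ord1.
Qed.

Lemma choi_mxE xi eta S i p j q : orthonormal_basis xi ->
  choi_mx xi eta S (mxtens_index (i, p)) (mxtens_index (j, q)) =
  ((eta p)^t* *m S (ketbra (xi i) (xi j)) *m eta q) 0 0.
Proof.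
move=> onb.
have E : choi_mx xi eta S = \sum_i \sum_j delta_mx i j *t
    ((basis_mx eta)^t* *m S (ketbra (xi i) (xi j)) *m basis_mx eta).
  rewrite /choi_mx mulmx_sumr mulmx_suml; apply: eq_bigr => i1 _.
  rewrite mulmx_sumr mulmx_suml; apply: eq_bigr => j1 _.
  rewrite adjmx_tens !tensmx_mul ketbra_basis_mx !mulmxA basis_mx_adj // mul1mx.
  by rewrite -!mulmxA basis_mx_adj // mulmx1.
rewrite E summxE (bigD1 i) //= summxE (bigD1 j) //= tensmxE mxE !eqxx mul1r.
rewrite !big1 ?addr0 => [|i' i'i|j' j'j].
- exact: basis_mx_form.
- rewrite summxE big1 // => j' _.
  by rewrite tensmxE mxE eq_sym (negPf i'i) mul0r.
- by rewrite tensmxE mxE (eq_sym j) (negPf j'j) andbF mul0r.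
Qed.

Lemma basis_mx_adjr xi :
  orthonormal_basis xi -> basis_mx xi *m (basis_mx xi)^t* = 1%:M.
Proof. by move=> onb; apply: mulmx1C; apply: basis_mx_adj. Qed.

Lemma choi_mxD xi eta S T : orthonormal_basis xi ->
  choi_mx xi eta (S + T) = choi_mx xi eta S + choi_mx xi eta T.
Proof.
move=> onb; apply/matrixP=> a b; case: (mxtens_indexP a) => i p.
case: (mxtens_indexP b) => j q.
by rewrite [RHS]mxE !choi_mxE // lfunE mulmxDr mulmxDl mxE.
Qed.

Lemma choi_mxZ xi eta k S : orthonormal_basis xi ->
  choi_mx xi eta (k *: S) = k *: choi_mx xi eta S.
Proof.
move=> onb; apply/matrixP=> a b; case: (mxtens_indexP a) => i p.
case: (mxtens_indexP b) => j q.
by rewrite [RHS]mxE !choi_mxE // lfunE -scalemxAr -scalemxAl mxE.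
Qed.

Lemma matrix_basis_ext eta X A : orthonormal_basis eta ->
  (forall p q, ((eta p)^t* *m X *m eta q) 0 0 = ((eta p)^t* *m A *m eta q) 0 0) ->
  X = A.
Proof.
move=> onb E.
have {}E : (basis_mx eta)^t* *m X *m basis_mx eta = (basis_mx eta)^t* *m A *m basis_mx eta.
  by apply/matrixP=> p q; rewrite !basis_mx_form.
have G Y : basis_mx eta *m ((basis_mx eta)^t* *m Y *m basis_mx eta) *m (basis_mx eta)^t* = Y.
  by rewrite !mulmxA basis_mx_adjr // mul1mx -mulmxA basis_mx_adjr // mulmx1.
by rewrite -[X]G -[A]G E.
Qed.

Lemma ketbra_expand xi A : orthonormal_basis xi ->
  A = \sum_i \sum_j ((xi i)^t* *m A *m xi j) 0 0 *: ketbra (xi i) (xi j).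
Proof.
move=> onb.
have {1}<- : basis_mx xi *m ((basis_mx xi)^t* *m A *m basis_mx xi) *m (basis_mx xi)^t* = A.
  by rewrite !mulmxA basis_mx_adjr // mul1mx -mulmxA basis_mx_adjr // mulmx1.
rewrite [X in _ *m X *m _]matrix_sum_delta mulmx_sumr mulmx_suml.
apply: eq_bigr => i _; rewrite mulmx_sumr mulmx_suml.
by apply: eq_bigr => j _; rewrite basis_mx_form ketbra_basis_mx -scalemxAr -scalemxAl.
Qed.

(** The Choi matrix records the map on the operators [ketbra (xi i) (xi j)], which span by
    [ketbra_expand]. *)
Lemma choi_mx_inj xi eta S T : orthonormal_basis xi -> orthonormal_basis eta ->
  choi_mx xi eta S = choi_mx xi eta T -> S = T.
Proof.
move=> onbx onbe E; apply/lfunP=> A.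
rewrite (ketbra_expand A onbx) !linear_sum; apply: eq_bigr => i _.
rewrite !linear_sum; apply: eq_bigr => j _; rewrite !linearZ; congr (_ *: _).
apply: (matrix_basis_ext onbe) => p q; rewrite -!choi_mxE //.
by rewrite E.
Qed.

Lemma conj_basis_orthonormal eta : orthonormal_basis eta ->
  orthonormal_basis (fun i => map_mx Num.conj (eta i)).
Proof.
move=> onb i j; have := onb j i; rewrite !mxE eq_sym => <-.
by apply: eq_bigr => k _; rewrite !mxE conjCK mulrC.
Qed.

(** [transposition] acts in standard coordinates while [eta] is arbitrary, so moving the transpose
    across the form conjugates the vectors of [eta]. Relative to that conjugate basis the effect is
    a partial transpose, exchanging [p] and [q]. *)
Lemma choi_mx_transposition xi eta S i p j q : orthonormal_basis xi ->
  choi_mx xi eta (transposition C n \o S)%VF (mxtens_index (i, p)) (mxtens_index (j, q)) =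
  choi_mx xi (fun i => map_mx Num.conj (eta i)) S
    (mxtens_index (i, q)) (mxtens_index (j, p)).
Proof.
move=> onb; rewrite !choi_mxE // lfunE /= transpositionE !adj_formE exchange_big.
apply: eq_bigr => a _; apply: eq_bigr => b _; rewrite !mxE conjCK; ring.
Qed.

Lemma choi_mx_psd_copositive xi eta S : orthonormal_basis xi ->
  completely_copositive S ->
  exists2 H : 'M[C]_(n * n), psdmx H &
  forall i p j q,
    choi_mx xi eta S (mxtens_index (i, p)) (mxtens_index (j, q)) =
    H (mxtens_index (i, q)) (mxtens_index (j, p)).
Proof.
move=> onb [S' cpS' ->].
exists (choi_mx xi (fun i => map_mx Num.conj (eta i)) S'); first exact: choi_mx_psd.
by move=> i p j q; rewrite choi_mx_transposition.
Qed.

(** The Kraus operator has matrix [M] in the two bases; its Choi matrix is the rank-one matrix of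
    the vectorised [M], so every rank-one positive table arises this way. *)
Lemma choi_mx_conj_map xi eta M i p j q :
  orthonormal_basis xi -> orthonormal_basis eta ->
  choi_mx xi eta (conj_map (basis_mx eta *m M *m (basis_mx xi)^t*))
    (mxtens_index (i, p)) (mxtens_index (j, q)) = M p i * (M q j)^*.
Proof.
move=> onbx onbe; rewrite choi_mxE // conj_mapE ketbra_basis_mx.
have colV (k : 'I_n) : eta k = basis_mx eta *m delta_mx k 0.
  by rewrite -colE; apply/matrixP=> a b; rewrite !mxE ord1.
rewrite !adjmxM !trmxCK !colV adjmxM !mulmxA.
rewrite -!mulmxA (mulmxA _ (basis_mx xi)) basis_mx_adj // mul1mx.
rewrite (mulmxA _ (basis_mx eta)) basis_mx_adj // mul1mx.
rewrite (mulmxA _ (basis_mx eta)) basis_mx_adj // mul1mx.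
rewrite (mulmxA _ (basis_mx xi)) basis_mx_adj // mul1mx.
rewrite trmx_delta map_delta_mx -(mul_delta_mx (0 : 'I_1) i j) -colE !mulmxA -rowE -colE.
by rewrite -mulmxA -rowE mxE big_ord1 !mxE.
Qed.

End CompletePositivity.

(** * The Choi tables of the map and of its two summands *)

Section ChoiTables.
Variable C : numClosedFieldType.
Implicit Types l mu y z t c : C.

(* [mu] stands for the square root of [l] in the two parts. *)
Definition face_choi l y z t := mx_of_rows
       [:: [:: 0;    0;      0;    y];
           [:: 0;    l;      z^*;  t];
           [:: 0;    z;      1;    0];
           [:: y^*;  t^*;    0;    1 - l] ].

Definition cocp_part l mu y z t c := mx_of_rows
       [:: [:: 0;    0;          0;          y];
           [:: 0;    `|y| * mu;  0;          t / 2];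
           [:: 0;    0;          `|y| / mu;  c];
           [:: y^*;  (t / 2)^*;  c^*;        `|z| / mu * (1 - l)] ].

Definition cp_part l mu y z t c := mx_of_rows
       [:: [:: 0;    0;          0;          0];
           [:: 0;    `|z| * mu;  z^*;        t / 2];
           [:: 0;    z;          `|z| / mu;  - c];
           [:: 0;    (t / 2)^*;  - c^*;      `|y| / mu * (1 - l)] ].

End ChoiTables.

(** * Maps on 2x2 matrices: rank-one tables, positivity and unitality *)

Section Qubit.
Variables (C : numClosedFieldType) (xi eta : 'I_2 -> 'cV[C]_2).
Hypotheses (xi_onb : orthonormal_basis xi) (eta_onb : orthonormal_basis eta).

Notation ix i p := (@mxtens_index 2 2 (i, p)).

Lemma ord2_ind (P : 'I_2 -> Prop) : P 0 -> P 1 -> forall i, P i.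
Proof.
move=> P0 P1 [[|[|//]] Hi].
- by rewrite (_ : Ordinal Hi = 0) //; apply: val_inj.
- by rewrite (_ : Ordinal Hi = 1) //; apply: val_inj.
Qed.

Lemma mx22_ext (A B : 'M[C]_(2 * 2)) :
  (forall i p j q, A (ix i p) (ix j q) = B (ix i p) (ix j q)) -> A = B.
Proof.
move=> E; apply/matrixP=> a b; case: (mxtens_indexP a) => i p.
by case: (mxtens_indexP b) => j q; apply: E.
Qed.

Lemma mx_of_rowsE (rows : seq (seq C)) i p j q :
  mx_of_rows rows (ix i p) (ix j q) = (nth [::] rows (i * 2 + p)%N)`_(j * 2 + q).
Proof. by rewrite mxE. Qed.

(** The second basis is a parameter because the copositive analogue takes the conjugate of [eta] for
    it. *)
Lemma rank1_cp_exists (zeta : 'I_2 -> 'cV[C]_2) (v : 'I_2 -> 'I_2 -> C) :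
  orthonormal_basis zeta ->
  exists S : 'End('M[C]_2), [/\ completely_positive S, positive_map S &
    forall i p j q, choi_mx xi zeta S (ix i p) (ix j q) = v i p * (v j q)^*].
Proof.
move=> onb.
exists (conj_map (basis_mx zeta *m (\matrix_(p, i) v i p) *m (basis_mx xi)^t*)).
split; [exact: conj_map_cp | exact: conj_map_positive | move=> i p j q].
by rewrite choi_mx_conj_map // !mxE.
Qed.

Lemma rank1_cocp_exists (w : 'I_2 -> 'I_2 -> C) :
  exists S : 'End('M[C]_2), [/\ completely_copositive S, positive_map S &
    forall i p j q, choi_mx xi eta S (ix i p) (ix j q) = w i q * (w j p)^*].
Proof.
have [S [cpS posS E]] := rank1_cp_exists w (conj_basis_orthonormal eta_onb).
exists (transposition C 2 \o S)%VF; split; first by exists S.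
- by move=> A psdA; rewrite lfunE; apply: transposition_positive; apply: posS.
- by move=> i p j q; rewrite choi_mx_transposition.
Qed.

Lemma positive_choi_form (T : 'End('M[C]_2)) (x w : 'I_2 -> C) : positive_map T ->
  0 <= \sum_i \sum_j x i * (x j)^* *
    \sum_p \sum_q (w p)^* * w q * choi_mx xi eta T (ix i p) (ix j q).
Proof.
move=> posT.
pose u := \sum_i x i *: xi i.
have [v vE] : {v | v = \sum_p w p *: eta p} by eexists.
have := posT _ (psdmx_outer u) v.
have adj_sum (f : 'I_2 -> C) (g : 'I_2 -> 'cV[C]_2) :
    (\sum_i f i *: g i)^t* = \sum_i (f i)^* *: (g i)^t*.
  apply/matrixP => a b; rewrite !(mxE, summxE) rmorph_sum.
  by apply: eq_bigr => k _; rewrite !mxE rmorphM.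
suff -> : (v^t* *m T (u *m u^t*) *m v) 0 0 =
    \sum_i \sum_j x i * (x j)^* *
    \sum_p \sum_q (w p)^* * w q * choi_mx xi eta T (ix i p) (ix j q) by [].
rewrite {1 2}/u adj_sum mulmx_suml [T _]linear_sum mulmx_sumr mulmx_suml summxE.
apply: eq_bigr => i _ /=.
rewrite mulmx_sumr [T _]linear_sum mulmx_sumr mulmx_suml summxE; apply: eq_bigr => j _ /=.
rewrite -scalemxAl -scalemxAr scalerA [T _]linearZ -scalemxAr -scalemxAl mxE.
congr (_ * _); rewrite vE adj_sum !mulmx_suml summxE; apply: eq_bigr => p _.
rewrite mulmx_sumr summxE; apply: eq_bigr => q _.
by rewrite -!scalemxAl -scalemxAr scalerA mxE choi_mxE.
Qed.

(** The partial trace of the Choi matrix over the first factor is [T 1%:M] written in the basis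
    [eta]. *)
Lemma unital_mapP (T : 'End('M[C]_2)) :
  unital_map T <->
  forall p q, \sum_i choi_mx xi eta T (ix i p) (ix i q) = (p == q)%:R.
Proof.
have E p q : ((eta p)^t* *m T 1%:M *m eta q) 0 0 =
    \sum_i choi_mx xi eta T (ix i p) (ix i q).
  rewrite (ketbra_expand 1%:M xi_onb) [T _]linear_sum mulmx_sumr mulmx_suml summxE.
  apply: eq_bigr => i _; rewrite choi_mxE // (bigD1 i) //= big1 => [|j ji].
    by rewrite mulmx1 xi_onb eqxx scale1r addr0.
  by rewrite mulmx1 xi_onb eq_sym (negPf ji) scale0r.
split=> [T1 p q|H]; first by rewrite -E T1 mulmx1 eta_onb.
by apply: (matrix_basis_ext eta_onb) => p q; rewrite E H mulmx1 eta_onb.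
Qed.

(** This is nonnegativity of the determinant of the image of the rank-one operator on
    [u *: xi 0 + xi 1]. *)
Lemma table_positive_form (T : 'End('M[C]_2)) (l y z t : C) : positive_map T ->
  choi_mx xi eta T = face_choi l y z t ->
  forall u : C, (u * y + u^* * z) * (u * y + u^* * z)^* <=
    l * (u * u^*) + (u * t + (u * t)^*) + (1 - l).
Proof.
move=> posT E u; rewrite -subr_ge0.
pose b := u * y + u^* * z.
(* The image has first diagonal entry 1 and off-diagonal entry [b], so its form at [(- b, 1)] equals
   its determinant. *)
have := positive_choi_form (fun i => if i == 0 then u else 1)
  (fun i => if i == 0 then - b else 1) posT.
rewrite E /face_choi !big_ord_recl !big_ord0 !mx_of_rowsE /= conjC1.
by rewrite /b !(rmorphN, rmorphD, rmorphM) /= !conjCK; congr (0 <= _); ring.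
Qed.

End Qubit.

(** * Existence of the decomposition *)

Section Decomposition.
Variables (C : numClosedFieldType) (xi eta : 'I_2 -> 'cV[C]_2).
Hypotheses (xi_onb : orthonormal_basis xi) (eta_onb : orthonormal_basis eta).

Notation ix i p := (@mxtens_index 2 2 (i, p)).

(** Both tables have rank one, the first after partial transposition: the modulus of [t] yields the
    last diagonal entries, and the phase relation makes the entries [c] and [- c] opposite.
    Positivity is recorded too, since the extremality argument rebuilds maps from such parts. *)
Lemma decomposition_exists (l mu y z t c : C) :
  0 < mu -> y != 0 -> z != 0 ->
  t * t^* = 4 * `|y| * `|z| * (1 - l) ->
  z * t * `|y| = - (y * t^* * `|z|) ->
  c = y * (t / 2)^* / (`|y| * mu) ->
  exists S1 S2 : 'End('M[C]_2),
  [/\ completely_copositive S1 /\ positive_map S1,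
      completely_positive S2 /\ positive_map S2,
      choi_mx xi eta S1 = cocp_part l mu y z t c &
      choi_mx xi eta S2 = cp_part l mu y z t c ].
Proof.
move=> mu_gt0 y0 z0 tE zt_yt cE.
have mu0 : mu != 0 by rewrite gt_eqF.
have p0 : `|y| != 0 by rewrite normr_eq0.
have q0 : `|z| != 0 by rewrite normr_eq0.
have two0 : (2 : C) != 0 by rewrite pnatr_eq0.
have root (x : C) : 0 < x -> {s : C | [/\ s != 0, s^* = s & s ^+ 2 = x * mu]}.
  move=> x0; have xm : 0 < x * mu by rewrite mulr_gt0.
  exists (sqrtC (x * mu)); rewrite sqrtCK; split=> //.
    by rewrite sqrtC_eq0 gt_eqF.
  by apply: conj_Creal; rewrite ger0_real // sqrtC_ge0 ltW.
have y_gt0 : 0 < `|y| by rewrite normr_gt0.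
have z_gt0 : 0 < `|z| by rewrite normr_gt0.
have [s [s0 sr s2]] := root _ y_gt0.
have [r [r0 rr r2]] := root _ z_gt0.
have two_real : (2 : C)^* = 2 by apply: conj_Creal; rewrite realn.
have mu_real : mu^* = mu by apply: conj_Creal; rewrite gtr0_real.
have p_real : `|y|^* = `|y| by apply: conj_Creal; apply: normr_real.
have tt2 : t / 2 * (t / 2)^* = `|y| * `|z| * (1 - l).
  rewrite rmorphM fmorphV /= two_real.
  have -> : t / 2 * (t^* / 2) = t * t^* / 4 by field.
  by rewrite tE; field.
have c_conj : c^* = y^* * (t / 2) / (`|y| * mu).
  by rewrite cE !(rmorphM, fmorphV) /= !conjCK ?two_real mu_real p_real.
have cz : - c = z * (t / 2) / (`|z| * mu).
  rewrite cE rmorphM fmorphV /= two_real.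
  have -> : z * (t / 2) = (z * t * `|y|) / (2 * `|y|) by field.
  by rewrite zt_yt; field; rewrite ?q0 ?p0 ?mu0.
have cz_conj : - c^* = z^* * (t / 2)^* / (`|z| * mu).
  by rewrite -rmorphN cz !(rmorphM, fmorphV) /= mu_real (conj_Creal (normr_real z)).
(* A rank-one positive matrix is recovered from one column divided by the square root of its
   diagonal entry; [s] and [r] are these roots for the second column. *)
have [S1 [coS1 posS1 E1]] := rank1_cocp_exists xi_onb eta_onb (fun i p =>
  if i == 0 then (if p == 0 then 0 else s) else (if p == 0 then y^* else (t / 2)^*) / s).
have [S2 [cpS2 posS2 E2]] := rank1_cp_exists xi_onb (fun i p =>
  if i == 0 then (if p == 0 then 0 else r) else (if p == 0 then z else (t / 2)^*) / r) eta_onb.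
have ss : s * s = `|y| * mu by rewrite -s2.
have rrE : r * r = `|z| * mu by rewrite -r2.
have yy : y^* * y = `|y| ^+ 2 by rewrite normCKC.
have zz : z * z^* = `|z| ^+ 2 by rewrite normCK.
have divs (a b : C) : a / s * (b / s) = a * b / (`|y| * mu) by rewrite -ss; field.
have divr (a b : C) : a / r * (b / r) = a * b / (`|z| * mu) by rewrite -rrE; field.
have h_conj : (t / 2)^* = t^* / 2 by rewrite rmorphM fmorphV /= two_real.
rewrite h_conj in cE cz_conj tt2 *.
have mulsK (a : C) : s * (a / s) = a by field.
have mulrK' (a : C) : r * (a / r) = a by field.
exists S1, S2; split=> //; apply: mx22_ext => i p j q.
  rewrite E1 /cocp_part mx_of_rowsE h_conj.
  elim/ord2_ind: i; elim/ord2_ind: p; elim/ord2_ind: j; elim/ord2_ind: q => /=;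
    rewrite ?conjC0 ?(mul0r, mulr0) ?rmorphM ?fmorphV /= ?conjCK ?sr ?two_real
      ?mul0r ?mulr0 ?mulsK ?divfK ?divs //.
  - by rewrite yy; field; rewrite ?p0 ?mu0.
  - by rewrite cE [t^* / 2 * y]mulrC.
  - by rewrite [t^* / 2 * _]mulrC tt2; field; rewrite ?p0 ?mu0.
rewrite E2 /cp_part mx_of_rowsE h_conj.
elim/ord2_ind: i; elim/ord2_ind: p; elim/ord2_ind: j; elim/ord2_ind: q => /=;
  rewrite ?conjC0 ?(mul0r, mulr0) ?rmorphM ?fmorphV /= ?conjCK ?rr ?two_real
    ?mul0r ?mulr0 ?mulrK' ?divfK ?divr //.
- by rewrite zz; field; rewrite ?q0 ?mu0.
- by rewrite cz_conj [t^* / 2 * z^*]mulrC.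
- by rewrite [t^* / 2 * _]mulrC tt2; field; rewrite ?q0 ?mu0.
Qed.

End Decomposition.

(** * Scalar inequalities and their equality cases *)

Section RealScalars.
Variable C : numClosedFieldType.

Lemma double_amgm (x a m : C) : 0 <= x -> 0 <= a -> 0 <= m ->
  m ^+ 2 <= x * a -> 2 * m <= x + a.
Proof.
move=> x0 a0 m0 mxa; rewrite -(@ler_pXn2r _ 2) ?nnegrE ?addr_ge0 ?mulr_ge0 //.
(* In [C] a square is nonnegative only when its argument is real. *)
have rD : x - a \is Num.real by rewrite rpredB ?ger0_real.
rewrite -subr_ge0; have -> : (x + a) ^+ 2 - (2 * m) ^+ 2 =
  (x - a) ^+ 2 + 4 * (x * a - m ^+ 2) by ring.
by rewrite addr_ge0 -?realEsqr // mulr_ge0 ?subr_ge0.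
Qed.

Lemma double_amgm_eq (x a m : C) : 0 <= x -> 0 <= a ->
  m ^+ 2 <= x * a -> x + a = 2 * m -> x = m /\ a = m.
Proof.
move=> x0 a0 mxa xa.
have rD : x - a \is Num.real by rewrite rpredB ?ger0_real.
have D0 : (x - a) ^+ 2 <= 0.
  have -> : (x - a) ^+ 2 = (x + a) ^+ 2 - 4 * (x * a) by ring.
  rewrite xa; have -> : (2 * m) ^+ 2 - 4 * (x * a) = 4 * (m ^+ 2 - x * a) by ring.
  by rewrite mulr_ge0_le0 // subr_le0.
have {D0} D0 : (x - a) ^+ 2 = 0 by apply/le_anti; rewrite D0 -realEsqr.
have xaE : x = a by apply/eqP; rewrite -subr_eq0 -sqrf_eq0 D0.
have two0 : (2 : C) != 0 by rewrite pnatr_eq0.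
have : 2 * a = 2 * m by rewrite -xa xaE; ring.
by move/(mulfI two0) => am; rewrite xaE am.
Qed.

(** After scaling [a1] and [a2] by [mu ^+ 2], AM-GM gives [2 p mu <= l1 + mu^2 a1] and
    [2 q mu <= l2 + mu^2 a2]. Both sides add up to [2 mu^2], so each inequality is an equality. *)
Lemma cauchy_schwarz_tight (l1 a1 l2 a2 p q mu : C) :
  0 <= l1 -> 0 <= a1 -> 0 <= l2 -> 0 <= a2 -> 0 <= p -> 0 <= q -> 0 < mu ->
  p ^+ 2 <= l1 * a1 -> q ^+ 2 <= l2 * a2 ->
  l1 + l2 = mu ^+ 2 -> a1 + a2 = 1 -> p + q = mu ->
  [/\ l1 = p * mu, a1 = p / mu, l2 = q * mu & a2 = q / mu].
Proof.
move=> l1_ge0 a1_ge0 l2_ge0 a2_ge0 p_ge0 q_ge0 mu_gt0 pla qla lE aE pq.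
have mu_ge0 := ltW mu_gt0; have mu0 : mu != 0 by rewrite gt_eqF.
have scale r x a : r ^+ 2 <= x * a -> (r * mu) ^+ 2 <= x * (mu ^+ 2 * a).
  move=> H; rewrite exprMn [X in _ <= X]mulrCA [X in X <= _]mulrC.
  by apply: ler_wpM2l; rewrite ?exprn_ge0.
have {pla} pla := scale _ _ _ pla; have {qla} qla := scale _ _ _ qla.
have ma1 : 0 <= mu ^+ 2 * a1 by rewrite mulr_ge0 ?exprn_ge0.
have ma2 : 0 <= mu ^+ 2 * a2 by rewrite mulr_ge0 ?exprn_ge0.
have X1 := double_amgm l1_ge0 ma1 (mulr_ge0 p_ge0 mu_ge0) pla.
have X2 := double_amgm l2_ge0 ma2 (mulr_ge0 q_ge0 mu_ge0) qla.
have sumX : (l1 + mu ^+ 2 * a1) + (l2 + mu ^+ 2 * a2) = 2 * (p * mu) + 2 * (q * mu).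
  transitivity ((l1 + l2) + mu ^+ 2 * (a1 + a2)); first by ring.
  by rewrite lE aE -pq; ring.
have E1 : l1 + mu ^+ 2 * a1 = 2 * (p * mu).
  apply/le_anti; rewrite X1 andbT -(lerD2r (l2 + mu ^+ 2 * a2)) sumX.
  by rewrite lerD2l.
have E2 : l2 + mu ^+ 2 * a2 = 2 * (q * mu) by move: sumX; rewrite E1 => /addrI.
have [l1E m1E] := double_amgm_eq l1_ge0 ma1 pla E1.
have [l2E m2E] := double_amgm_eq l2_ge0 ma2 qla E2.
have div r a : mu ^+ 2 * a = r * mu -> a = r / mu.
  move=> H; apply: (mulfI (expf_neq0 2 mu0)); rewrite H; field.
  by rewrite ?mu0.
by split=> //; apply: div.
Qed.

(** By the parallelogram law [|t1 - t2|^2 = 2 |t1|^2 + 2 |t2|^2 - 4 s], which the two bounds make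
    nonpositive. *)
Lemma parallelogram_tight (t1 t2 s : C) :
  t1 * t1^* <= s -> t2 * t2^* <= s -> (t1 + t2) * (t1 + t2)^* = 4 * s ->
  t1 = t2 /\ t1 * t1^* = s.
Proof.
move=> H1 H2 E.
have D : (t1 - t2) * (t1 - t2)^* = 2 * (t1 * t1^*) + 2 * (t2 * t2^*) - 4 * s.
  by rewrite -E !rmorphD !rmorphN /=; ring.
have D0 : (t1 - t2) * (t1 - t2)^* = 0.
  apply/le_anti; rewrite mul_conjC_ge0 andbT D subr_le0.
  have -> : 4 * s = 2 * s + 2 * s by ring.
  by rewrite lerD // ler_pM2l.
have t12 : t1 = t2 by apply/eqP; rewrite -subr_eq0 -mul_conjC_eq0 D0.
split=> //; have four0 : (4 : C) != 0 by rewrite pnatr_eq0.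
by apply: (mulfI four0); rewrite -E -t12 !rmorphD; ring.
Qed.

End RealScalars.

(** * Uniqueness of the decomposition *)

Section Uniqueness.
Variables (C : numClosedFieldType) (xi eta : 'I_2 -> 'cV[C]_2).
Hypothesis xi_onb : orthonormal_basis xi.

Notation ix i p := (@mxtens_index 2 2 (i, p)).

Lemma decomposition_unique (S1 S2 : 'End('M[C]_2)) (l mu y z t c : C) :
  completely_copositive S1 -> completely_positive S2 ->
  0 < mu -> mu ^+ 2 = l -> `|y| + `|z| = mu -> y != 0 -> z != 0 ->
  t * t^* = 4 * (`|y| * `|z| * (1 - l)) ->
  c = y * (t / 2)^* / (`|y| * mu) ->
  choi_mx xi eta (S1 + S2) = face_choi l y z t ->
  choi_mx xi eta S1 = cocp_part l mu y z t c.
Proof.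
move=> coS1 cpS2 mu_gt0 mul2 sum_yz y0 z0 tE cE tab.
have mu0 : mu != 0 by rewrite gt_eqF.
have p0 : `|y| != 0 by rewrite normr_eq0.
have q0 : `|z| != 0 by rewrite normr_eq0.
have y_gt0 : 0 < `|y| by rewrite normr_gt0.
have z_gt0 : 0 < `|z| by rewrite normr_gt0.
have two0 : (2 : C) != 0 by rewrite pnatr_eq0.
have [H psdH HE] := choi_mx_psd_copositive eta xi_onb coS1.
have psdK := choi_mx_psd xi eta cpS2.
rewrite choi_mxD // in tab.
move: psdK tab; set K := choi_mx xi eta S2 => psdK tab.
(* [H] is the positive partial transpose of the Choi matrix of [S1], hence the exchange of [p] and
   [q] in its indices. *)
have E i p j q : H (ix i q) (ix j p) + K (ix i p) (ix j q) =
    (nth [::] [:: [:: 0;    0;      0;    y];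
           [:: 0;    l; z^*;  t];
           [:: 0;    z;      1;    0];
           [:: y^*;  t^*;    0;    1 - l] ] (i * 2 + p)%N)`_(j * 2 + q).
  by rewrite -mx_of_rowsE -/(face_choi l y z t) -tab [RHS]mxE HE.
have Hge a : 0 <= H a a by apply: psdmx_diag_ge0.
have Kge a : 0 <= K a a by apply: psdmx_diag_ge0.
(* A zero diagonal entry clears its row and column in both [H] and [K]. The slot of [y] in [K] and,
   after the exchange, that of [z^*] in [H] lie there, so [H] carries all of [y] and [K] all of
   [z^*]. *)
have /eqP := E 0 0 0 0; rewrite /= paddr_eq0 // => /andP[/eqP H00 /eqP K00].
have H0r a : H a (ix 0 0) = 0 by apply: psdmx_diag0.
have K0r a : K a (ix 0 0) = 0 by apply: psdmx_diag0.
have H0l a : H (ix 0 0) a = 0 by rewrite (psdmx_herm a _ psdH) H0r conjC0.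
have K0l a : K (ix 0 0) a = 0 by rewrite (psdmx_herm a _ psdK) K0r conjC0.
have Hy : H (ix 0 1) (ix 1 0) = y by have := E 0 0 1 1; rewrite K0l addr0.
have Kz : K (ix 0 1) (ix 1 0) = z^* by have := E 0 1 1 0; rewrite H0l add0r.
have El := E 0 1 0 1; have Ea := E 1 0 1 0; have Eb := E 1 1 1 1.
have Et := E 0 1 1 1; have Ec := E 1 0 1 1.
rewrite /= in El Ea Eb Et Ec.
have mH := psdmx_minor (ix 0 1) (ix 1 0) psdH; rewrite Hy in mH.
have mK := psdmx_minor (ix 0 1) (ix 1 0) psdK; rewrite Kz norm_conjC in mK.
rewrite -mul2 in El.
have [l1E a1E l2E a2E] := cauchy_schwarz_tight (Hge _) (Hge _) (Kge _) (Kge _)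
  (normr_ge0 y) (normr_ge0 z) mu_gt0 mH mK El Ea sum_yz.
have rH := @psdmx_rank1 _ _ H (ix 0 1) (ix 1 0) (ix 1 1) psdH.
have rK := @psdmx_rank1 _ _ K (ix 0 1) (ix 1 0) (ix 1 1) psdK.
rewrite l1E a1E Hy in rH; rewrite l2E a2E Kz norm_conjC in rK.
(* The diagonal entries just found make both minors singular. *)
have {}rH := rH ltac:(by field; rewrite ?mu0).
have {}rK := rK ltac:(by field; rewrite ?mu0).
have nH := psdmx_minor (ix 0 1) (ix 1 1) psdH.
have nK := psdmx_minor (ix 0 1) (ix 1 1) psdK.
rewrite l1E in nH; rewrite l2E in nK.
rewrite (psdmx_herm (ix 0 1) (ix 1 1) psdH) in rH.
rewrite (psdmx_herm (ix 0 1) (ix 1 1) psdK) (psdmx_herm (ix 1 0) (ix 1 1) psdK) in rK.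
(* The zero of the table at this place ties the two parts through one entry [g]; the rank-one
   relations then give both shares of [t] the modulus [|g| mu]. *)
have {}Ec : K (ix 1 0) (ix 1 1) = - H (ix 1 1) (ix 1 0).
  by apply/eqP; rewrite -addr_eq0 addrC Ec.
rewrite Ec rmorphN /= in rK.
move: rH rK nH nK Et Eb.
set t1 := H (ix 0 1) (ix 1 1); set t2 := K (ix 0 1) (ix 1 1).
set g := H (ix 1 1) (ix 1 0); set b1 := H (ix 1 1) (ix 1 1).
set b2 := K _ _ => rH rK nH nK Et Eb.
have g1 : `|t1| = `|g| * mu.
  apply: (mulIf p0); rewrite -[in LHS](norm_conjC t1) -normrM rH !normrM normr_id.
  by rewrite (gtr0_norm mu_gt0); ring.
have g2 : `|t2| = `|g| * mu.
  apply: (mulIf q0); rewrite -[in LHS](norm_conjC t2) -{1}(norm_conjC z) -normrM rK.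
  by rewrite !normrM normrN normr_id norm_conjC (gtr0_norm mu_gt0); ring.
(* Adding the two minors with weights [|z|] and [|y|] leaves only the sum [b1 + b2], which is
   [1 - l]. *)
have tau : t1 * t1^* <= `|y| * `|z| * (1 - l).
  rewrite -normCK -(ler_pM2l mu_gt0) -{1}sum_yz -Eb.
  have -> : (`|y| + `|z|) * `|t1| ^+ 2 = `|z| * `|t1| ^+ 2 + `|y| * `|t2| ^+ 2.
    by rewrite g2 g1; ring.
  have -> : mu * (`|y| * `|z| * (b1 + b2)) =
    `|z| * (`|y| * mu * b1) + `|y| * (`|z| * mu * b2) by ring.
  by rewrite lerD // ler_pM2l.
have tau2 : t2 * t2^* <= `|y| * `|z| * (1 - l) by rewrite -normCK g2 -g1 normCK.
rewrite -Et in tE.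
have [t12 tauE] := parallelogram_tight tau tau2 tE.
have t1E : t1 = t / 2 by rewrite -Et -t12; field.
(* The minors bound [b1] and [b2] below by values that add up to [1 - l], as [|y| + |z| = mu]; hence
   both bounds are attained. *)
have b1E : b1 = `|z| / mu * (1 - l).
  have b1_ge : `|z| / mu * (1 - l) <= b1.
    rewrite -(ler_pM2l (mulr_gt0 y_gt0 mu_gt0)); apply: le_trans nH.
    rewrite normCK tauE le_eqVlt; apply/orP; left; apply/eqP; field.
    by rewrite ?mu0.
  have b2_ge : `|y| / mu * (1 - l) <= b2.
    rewrite -(ler_pM2l (mulr_gt0 z_gt0 mu_gt0)); apply: le_trans nK.
    rewrite normCK -t12 tauE le_eqVlt; apply/orP; left; apply/eqP; field.
    by rewrite ?mu0.
  apply/le_anti; rewrite b1_ge andbT -(lerD2r b2) Eb -lerBlDl.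
  apply: le_trans b2_ge; rewrite le_eqVlt; apply/orP; left; apply/eqP.
  by rewrite -sum_yz; field; rewrite ?sum_yz.
have gE : g = c.
  apply: (mulIf (mulf_neq0 p0 mu0)); rewrite -rH cE t1E; field.
  by rewrite ?mu0 ?p0.
apply: mx22_ext => i p j q; rewrite HE /cocp_part mx_of_rowsE.
elim/ord2_ind: i; elim/ord2_ind: p; elim/ord2_ind: j; elim/ord2_ind: q => /=;
  rewrite ?H0l ?H0r ?Hy ?l1E ?a1E -/t1 -/g -/b1 ?t1E ?gE ?b1E //.
- by rewrite (psdmx_herm (ix 0 1) (ix 1 0) psdH) Hy.
- by rewrite (psdmx_herm (ix 0 1) (ix 1 1) psdH) -/t1 t1E.
- by rewrite (psdmx_herm (ix 1 1) (ix 1 0) psdH) -/g gE.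
Qed.

End Uniqueness.

(** * Admissible values of [t] and extremality *)

Section Extremality.
Variables (C : numClosedFieldType) (xi eta : 'I_2 -> 'cV[C]_2).
Hypotheses (xi_onb : orthonormal_basis xi) (eta_onb : orthonormal_basis eta).

Notation ix i p := (@mxtens_index 2 2 (i, p)).

Lemma parts_sum (l mu y z t c : C) :
  0 < mu -> mu ^+ 2 = l -> `|y| + `|z| = mu ->
  cocp_part l mu y z t c + cp_part l mu y z t c = face_choi l y z t.
Proof.
move=> mu_gt0 mul2 sum_yz; have mu0 : mu != 0 by rewrite gt_eqF.
have halves (a : C) : a / 2 + a / 2 = a by field.
apply: mx22_ext => i p j q; rewrite mxE /cocp_part /cp_part /face_choi !mx_of_rowsE.
elim/ord2_ind: i; elim/ord2_ind: p; elim/ord2_ind: j; elim/ord2_ind: q => /=;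
  rewrite ?addr0 ?add0r ?halves -?mulrDl ?sum_yz ?[_ + `|y|]addrC ?sum_yz ?divff
     ?mul1r ?subrr // -?rmorphD ?halves //.
Qed.

Lemma face_choi_unital (T : 'End('M[C]_2)) (l y z t : C) :
  choi_mx xi eta T = face_choi l y z t -> unital_map T.
Proof.
move=> E; apply/(unital_mapP xi_onb eta_onb); rewrite E => p q.
rewrite !big_ord_recl big_ord0 /face_choi !mx_of_rowsE.
elim/ord2_ind: p; elim/ord2_ind: q => /=; rewrite ?addr0 ?add0r //.
by rewrite subrKC.
Qed.

(* Testing positivity on the projections onto [r *: e] and [r 'i *: e], where
   the phase [e] aligns [e y] with [e^* z]: on the first one the determinant
   is affine in [r]. *)
Lemma face_choi_phase (T : 'End('M[C]_2)) (l y z t : C) :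
  positive_map T -> choi_mx xi eta T = face_choi l y z t ->
  (`|y| + `|z|) ^+ 2 = l -> y != 0 -> z != 0 ->
  exists e s : C, [/\ e * e^* = 1, e ^+ 2 = z * y^* / (`|y| * `|z|),
    s \is Num.real, e * t = 'i * s & s ^+ 2 <= 4 * `|y| * `|z| * (1 - l)].
Proof.
move=> posT E lE y0 z0.
have form := table_positive_form xi_onb posT E.
have p0 : `|y| != 0 by rewrite normr_eq0.
have q0 : `|z| != 0 by rewrite normr_eq0.
have y_gt0 : 0 < `|y| by rewrite normr_gt0.
have z_gt0 : 0 < `|z| by rewrite normr_gt0.
pose e := sqrtC (z * y^* / (`|y| * `|z|)).
have e2 : e ^+ 2 = z * y^* / (`|y| * `|z|) by rewrite sqrtCK.
have ee : e * e^* = 1.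
  have : `|e| ^+ 2 = 1.
    rewrite -normrX e2 !normrM normfV norm_conjC normrM !normr_id; field.
    by rewrite ?p0 ?q0.
  by rewrite normCK.
have yy := normCK y; have zz := normCK z.
have cross : (e * y) * (e * z^*) = `|y| * `|z|.
  transitivity (e ^+ 2 * (y * z^*)); first by ring.
  transitivity (`|y| ^+ 2 * `|z| ^+ 2 / (`|y| * `|z|)).
    by rewrite e2 yy zz; ring.
  by field; rewrite ?p0 ?q0.
have cross' : (e^* * y^*) * (e^* * z) = `|y| * `|z|.
  have : ((e * y) * (e * z^*))^* = (`|y| * `|z|)^* by rewrite cross.
  by rewrite !rmorphM /= !conjCK !(conj_Creal (normr_real _)).
have lR : l \is Num.real by rewrite -lE rpredX ?rpredD ?normr_real.
pose x := e * t + (e * t)^*.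
have x0 : x = 0.
  apply/eqP; apply/negP => /negP x0.
  have xR : x^* = x by rewrite /x rmorphD /= conjCK addrC.
  (* At [r * e] the terms [r ^+ 2 * l] cancel and [r * x + (1 - l)] remains; this [r] makes it
     -1. *)
  have [r rE] : {r | r = - (2 - l) / x} by eexists.
  have rR : r^* = r.
    by rewrite rE rmorphM rmorphN rmorphB fmorphV /= xR (conj_Creal lR) conj_Creal ?realn.
  have := form (r * e).
  rewrite !(rmorphM, rmorphD) /= !conjCK rR.
  have -> : (r * e * y + r * e^* * z) * (r * e^* * y^* + r * e * z^*) = r ^+ 2 * l.
    transitivity (r ^+ 2 * ((e * e^*) * (y * y^*) + (e * e^*) * (z * z^*)
       + (e * y) * (e * z^*) + (e^* * y^*) * (e^* * z))); first by ring.
    by rewrite ee cross cross' -yy -zz -lE; ring.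
  rewrite -subr_ge0.
  have -> : l * (r * e * (r * e^*)) + (r * e * t + r * e^* * t^*) + (1 - l) - r ^+ 2 * l
     = -1.
    transitivity (l * r ^+ 2 * (e * e^* - 1) + r * (e * t + e^* * t^*) + (1 - l)).
      by ring.
    by rewrite ee -rmorphM -/x rE; field.
  by rewrite oppr_ge0 ler10.
have [s sE] : {s | s = - 'i * (e * t)} by eexists.
have etE : e * t = 'i * s.
  by rewrite sE mulrA mulrN -expr2 sqrCi opprK mul1r.
have sR : s^* = s.
  have -> : s^* = 'i * (e * t)^* by rewrite sE rmorphM rmorphN /= conjCi opprK.
  by rewrite -[(e * t)^*](addKr (e * t)) -/x x0 addr0 sE mulrN mulNr.
exists e, s; split=> //; first by rewrite CrealE sR.
(* The minimizer of [(1 - l) - 2 r s + 4 |y| |z| r^2], where [4 |y| |z|] comes from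
   [l - (|y| - |z|)^2]. *)
have [r rE] : {r | r = s / (4 * `|y| * `|z|)} by eexists.
have rR : r^* = r.
  by rewrite rE rmorphM fmorphV !rmorphM /= sR !(conj_Creal (normr_real _)) conj_Creal ?realn.
have := form ('i * r * e).
rewrite !(rmorphM, rmorphD) /= !conjCK rR conjCi.
have -> : ('i * r * e * y + - 'i * r * e^* * z) *
          (- 'i * r * e^* * y^* + 'i * r * e * z^*) =
          r ^+ 2 * (`|y| - `|z|) ^+ 2.
  transitivity (- ('i ^+ 2) * r ^+ 2 * ((e * e^*) * (y * y^*) + (e * e^*) * (z * z^*)
       - (e * y) * (e * z^*) - (e^* * y^*) * (e^* * z))); first by ring.
  by rewrite ee cross cross' -yy -zz sqrCi; ring.
rewrite -[X in _ + (X + _) + _]mulrA -[X in _ + (_ + X) + _]mulrA -rmorphM /= etE.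
rewrite rmorphM /= conjCi sR -subr_ge0.
set F := _ - _.
have {F} -> : F = (1 - l) - s ^+ 2 / (4 * `|y| * `|z|).
  transitivity (- ('i ^+ 2) * (e * e^*) * l * r ^+ 2 + 'i ^+ 2 * (2 * r * s)
     - r ^+ 2 * (`|y| - `|z|) ^+ 2 + (1 - l)); first by rewrite /F; ring.
  rewrite sqrCi ee -lE rE; field.
  by rewrite ?p0 ?q0.
by rewrite subr_ge0 ler_pdivrMr ?mulr_gt0 // mulrC.
Qed.

(** The alignment reads [e^* z / |z| = e y / |y|], and conjugating the factor ['i] of [t] supplies
    the sign. This is the condition, free of [e], that [decomposition_exists] takes. *)
Lemma phase_relation (y z t e s : C) : y != 0 -> z != 0 ->
  e * e^* = 1 -> e ^+ 2 = z * y^* / (`|y| * `|z|) -> s \is Num.real ->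
  t = 'i * s * e^* ->
  z * t * `|y| = - (y * t^* * `|z|).
Proof.
move=> y0 z0 ee e2 /conj_Creal sR ->.
have p0 : `|y| != 0 by rewrite normr_eq0.
have q0 : `|z| != 0 by rewrite normr_eq0.
have H : z * e^* * `|y| = e * y * `|z|.
  transitivity (e^* * (z * (`|y| ^+ 2) / (`|y| * `|z|)) * `|z|).
    by field; rewrite ?p0 ?q0.
  rewrite normCK; transitivity (e^* * (y * e ^+ 2) * `|z|).
    by rewrite e2; ring.
  by transitivity ((e * e^*) * (e * y * `|z|)); [ring | rewrite ee mul1r].
rewrite !rmorphM /= conjCi sR conjCK.
by transitivity ('i * s * (z * e^* * `|y|)); [ring | rewrite H; ring].
Qed.

(** At an end of the admissible segment the two parts exist, and their sum is the required map. *)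
Lemma face_choi_exists (l mu y z t e s : C) :
  0 < mu -> mu ^+ 2 = l -> `|y| + `|z| = mu -> y != 0 -> z != 0 ->
  e * e^* = 1 -> e ^+ 2 = z * y^* / (`|y| * `|z|) -> s \is Num.real ->
  t = 'i * s * e^* -> s ^+ 2 = 4 * `|y| * `|z| * (1 - l) ->
  exists2 T : 'End('M[C]_2), unital_map T /\ positive_map T &
    choi_mx xi eta T = face_choi l y z t.
Proof.
move=> mu_gt0 mul2 sum_yz y0 z0 ee e2 sR tE s2.
have tt : t * t^* = 4 * `|y| * `|z| * (1 - l).
  rewrite -s2 tE !rmorphM /= conjCi (conj_Creal sR) conjCK.
  transitivity (- 'i ^+ 2 * s ^+ 2 * (e * e^*)); first by ring.
  by rewrite sqrCi ee; ring.
have rel := phase_relation y0 z0 ee e2 sR tE.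
have [S1 [S2 [[_ pos1] [_ pos2] E1 E2]]] :=
  decomposition_exists xi_onb eta_onb mu_gt0 y0 z0 tt rel erefl.
have E : choi_mx xi eta (S1 + S2) = face_choi l y z t.
  by rewrite choi_mxD // E1 E2 parts_sum.
exists (S1 + S2) => //; split; first exact: face_choi_unital E.
by move=> A psdA; rewrite lfunE; apply: psdmxD; [apply: pos1 | apply: pos2].
Qed.

(* If the bound on [s] were strict, moving [t] along its line up to both ends
   of the admissible segment would write T as a proper convex combination. *)
Lemma face_choi_extremal (T : 'End('M[C]_2)) (l mu y z t : C) :
  extremal_map T -> choi_mx xi eta T = face_choi l y z t ->
  0 < mu -> mu ^+ 2 = l -> `|y| + `|z| = mu -> y != 0 -> z != 0 ->
  t * t^* = 4 * `|y| * `|z| * (1 - l) /\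
  z * t * `|y| = - (y * t^* * `|z|).
Proof.
move=> [[_ posT] ext] E mu_gt0 mul2 sum_yz y0 z0.
have lE : (`|y| + `|z|) ^+ 2 = l by rewrite sum_yz.
have [e [s [ee e2 sR et s2_le]]] := face_choi_phase posT E lE y0 z0.
have tE : t = 'i * s * e^*.
  by rewrite -et; transitivity ((e * e^*) * t); [rewrite ee mul1r | ring].
split; last exact: phase_relation ee e2 sR tE.
have tt : t * t^* = s ^+ 2.
  rewrite tE !rmorphM /= conjCi (conj_Creal sR) conjCK.
  transitivity (- 'i ^+ 2 * s ^+ 2 * (e * e^*)); first by ring.
  by rewrite sqrCi ee; ring.
rewrite tt; apply/eqP; rewrite eq_le s2_le /=; apply/negP => /negP ns.
set M := 4 * _ * _ * _ in s2_le ns.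
have s2_ge0 : 0 <= s ^+ 2 by rewrite -realEsqr.
have M_ge0 : 0 <= M by apply: le_trans s2_le.
have s2_lt : s ^+ 2 < M.
  by rewrite lt_def s2_le andbT; apply: contra ns => /eqP ->.
pose s0 := sqrtC M.
have s02 : s0 ^+ 2 = M by rewrite sqrtCK.
have s0_gt0 : 0 < s0 by rewrite sqrtC_gt0; apply: le_lt_trans s2_lt.
have s00 : s0 != 0 by rewrite gt_eqF.
have s0R : s0 \is Num.real by rewrite gtr0_real.
have Ns0R : - s0 \is Num.real by rewrite rpredN.
have Ns02 : (- s0) ^+ 2 = M by rewrite sqrrN.
have [Tp KTp Ep] := face_choi_exists mu_gt0 mul2 sum_yz y0 z0 ee e2 s0R erefl s02.
have [Tm KTm Em] := face_choi_exists mu_gt0 mul2 sum_yz y0 z0 ee e2 Ns0R erefl Ns02.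
have : - s0 < s < s0.
  rewrite -real_ltr_norml // -(@ltr_pXn2r _ 2) ?nnegrE ?normr_ge0 ?(ltW s0_gt0) //.
  by rewrite real_normK // s02.
case/andP=> s_gt s_lt.
(* The weight for which [sigma * s0 + (1 - sigma) * - s0 = s]. *)
pose sigma := (1 + s / s0) / 2.
have two0 : (2 : C) != 0 by rewrite pnatr_eq0.
have sg0 : 0 < sigma.
  have -> : sigma = (s - - s0) / (2 * s0) by rewrite /sigma; field; rewrite ?s00.
  by rewrite divr_gt0 ?mulr_gt0 ?subr_gt0.
have sg1 : sigma < 1.
  rewrite -subr_gt0.
  have -> : 1 - sigma = (s0 - s) / (2 * s0) by rewrite /sigma; field; rewrite ?s00.
  by rewrite divr_gt0 ?mulr_gt0 ?subr_gt0.
have Tconv : T = sigma *: Tp + (1 - sigma) *: Tm.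
  apply: (choi_mx_inj xi_onb eta_onb).
  rewrite choi_mxD // !choi_mxZ // E Ep Em.
  have sgR : sigma^* = sigma by apply: conj_Creal; rewrite gtr0_real.
  have sgR1 : (1 - sigma)^* = 1 - sigma.
    by apply: conj_Creal; rewrite gtr0_real // subr_gt0.
  have tsum : t = sigma * ('i * s0 * e^*) + (1 - sigma) * ('i * - s0 * e^*).
    by rewrite tE /sigma; field; rewrite ?s00.
  have comb (a : C) : a = sigma * a + (1 - sigma) * a by ring.
  have tsum' : t^* = sigma * ('i * s0 * e^*)^* + (1 - sigma) * ('i * - s0 * e^*)^*.
    by rewrite {1}tsum rmorphD (rmorphM _ sigma) (rmorphM _ (1 - sigma)) /= sgR sgR1.
  apply: mx22_ext => i p j q.
  rewrite [RHS]mxE [X in _ = X + _]mxE [X in _ = _ + X]mxE /face_choi !mx_of_rowsE.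
  by elim/ord2_ind: i; elim/ord2_ind: p; elim/ord2_ind: j; elim/ord2_ind: q => /=.
(* Extremality identifies [T] with the end [Tp], so [s = s0], against [s < s0]. *)
have [TpT _] := ext Tp Tm sigma KTp KTm (introT andP (conj sg0 sg1)) Tconv.
have tpE : 'i * s0 * e^* = t.
  have : choi_mx xi eta Tp (ix 0 1) (ix 1 1) =
         choi_mx xi eta T (ix 0 1) (ix 1 1) by rewrite TpT.
  by rewrite Ep E /face_choi !mx_of_rowsE.
move: s_lt; rewrite lt_neqAle => /andP[/eqP[]]; apply: (mulfI (neq0Ci C)).
by rewrite -et -tpE; transitivity ('i * s0 * (e * e^*)); [ring | rewrite ee mulr1].
Qed.

End Extremality.

(** Conjugating the defining equation and using [|y| = y1 y1^*] eliminates [y1], so both square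
    roots of [y] give the same [c]. *)
Lemma phase_of_sqrt (C : numClosedFieldType) (l y y1 t c : C) :
  0 < l -> y != 0 -> y1 ^+ 2 = y ->
  y1^* * (4.-root l)^-1 * t = y1 * 4.-root l * c^* ->
  c = y * t^* / (`|y| * sqrtC l).
Proof.
move=> l_gt0 y0 y1E; set rho := 4.-root l => H.
have rho_gt0 : 0 < rho by rewrite rootC_gt0.
have rho0 : rho != 0 by rewrite gt_eqF.
have rhoR : rho^* = rho by apply: conj_Creal; rewrite gtr0_real.
have -> : sqrtC l = rho ^+ 2.
  by rewrite -[RHS]sqrCK ?exprn_ge0 ?ltW // -exprM rootCK.
have y10 : y1 != 0 by apply: contraNneq y0 => y10; rewrite -y1E y10 expr0n.
have y1c0 : y1^* != 0 by rewrite conjC_eq0.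
have -> : `|y| = y1 * y1^* by rewrite -y1E normrX normCK.
have : (y1^* * rho^-1 * t)^* = (y1 * rho * c^*)^* by rewrite H.
rewrite !rmorphM fmorphV /= !conjCK rhoR => {}H.
apply: (mulfI (mulf_neq0 y1c0 rho0)); rewrite -H -y1E; field.
by rewrite ?y10 ?y1c0 ?rho0.
Qed.

(* The complex numbers are R[i]; 0 <= lambda <= 1 in R[i] makes lambda real. *)
Theorem mainTheorem1 (R : realType)
    (xi eta : 'I_2 -> 'cV[R[i]]_2)
    (T T1 T2 : 'End('M[R[i]]_2))
    (lambda y z t y1 c : R[i])
    (xi_onb : orthonormal_basis xi)
    (eta_onb : orthonormal_basis eta)
    (T_unital : unital_map T)
    (T_positive : positive_map T)
    (T_face : T (ketbra (xi 0) (xi 0)) *m eta 0 = 0)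
    (lambda01 : 0 <= lambda <= 1)
    (T_choi : choi_mx xi eta T = mx_of_rows
       [:: [:: 0;    0;      0;    y];
           [:: 0;    lambda; z^*;  t];
           [:: 0;    z;      1;    0];
           [:: y^*;  t^*;    0;    1 - lambda] ])
    (lambda_neq0 : lambda != 0)
    (y_neq0 : y != 0)
    (z_neq0 : z != 0)
    (T_extremal : extremal_map T)
    (yz_sum : `|y| + `|z| = sqrtC lambda)
    (y1_def : y1 ^+ 2 = y) :
  let t1 := t / 2 in
  let t2 := t / 2 in
  let a1 := `|y| / sqrtC lambda in
  let lambda1 := `|y| * sqrtC lambda in
  let b1 := `|z| / sqrtC lambda * (1 - lambda) in
  let a2 := `|z| / sqrtC lambda in
  let lambda2 := `|z| * sqrtC lambda in
  let b2 := `|y| / sqrtC lambda * (1 - lambda) in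
  y1^* * (4.-root lambda)^-1 * t1 = y1 * 4.-root lambda * c^* ->
  choi_mx xi eta T1 = mx_of_rows
       [:: [:: 0;    0;       0;    y];
           [:: 0;    lambda1; 0;    t1];
           [:: 0;    0;       a1;   c];
           [:: y^*;  t1^*;    c^*;  b1] ] ->
  choi_mx xi eta T2 = mx_of_rows
       [:: [:: 0;    0;       0;       0];
           [:: 0;    lambda2; z^*;     t2];
           [:: 0;    z;       a2;      - c];
           [:: 0;    t2^*;    - c^*;   b2] ] ->
  [/\ T = T1 + T2,
      completely_positive T2,
      completely_copositive T1 &
      forall S1 S2 : 'End('M[R[i]]_2),
        completely_copositive S1 -> completely_positive S2 ->
        T = S1 + S2 -> S1 = T1 /\ S2 = T2].
Proof.
move=> t1 t2 a1 lambda1 b1 a2 lambda2 b2 c_def T1_choi T2_choi.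
have [_ posT] := T_extremal.1.
have lambda_gt0 : 0 < lambda by rewrite lt_def lambda_neq0; case/andP: lambda01.
have mu_gt0 : 0 < sqrtC lambda by rewrite sqrtC_gt0.
have [tt rel] := face_choi_extremal xi_onb eta_onb T_extremal T_choi mu_gt0
  (sqrtCK lambda) yz_sum y_neq0 z_neq0.
have cE := phase_of_sqrt lambda_gt0 y_neq0 y1_def c_def.
have [S1 [S2 [[coS1 _] [cpS2 _] E1 E2]]] :=
  decomposition_exists xi_onb eta_onb mu_gt0 y_neq0 z_neq0 tt rel cE.
(* [T1] and [T2] are known only through their tables, which identify them with the constructed
   maps. *)
have T1E : T1 = S1.
  by apply: (choi_mx_inj xi_onb eta_onb); rewrite E1; exact: T1_choi.
have T2E : T2 = S2.
  by apply: (choi_mx_inj xi_onb eta_onb); rewrite E2; exact: T2_choi.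
have T12 : T = T1 + T2.
  apply: (choi_mx_inj xi_onb eta_onb).
  rewrite choi_mxD // T1_choi T2_choi T_choi; apply/esym.
  exact: parts_sum mu_gt0 (sqrtCK lambda) yz_sum.
split; [exact: T12 | rewrite T2E; exact: cpS2 | rewrite T1E; exact: coS1 |].
move=> R1 R2 coR1 cpR2 TR.
(* Once the copositive summand is determined, the other follows by cancellation. *)
have R1E : R1 = T1.
  apply: (choi_mx_inj xi_onb eta_onb); rewrite T1_choi.
  rewrite TR in T_choi.
  apply: (decomposition_unique xi_onb coR1 cpR2 mu_gt0 (sqrtCK lambda) yz_sum
    y_neq0 z_neq0 _ cE T_choi).
  by rewrite tt !mulrA.
split; first exact: R1E.
by apply: (addrI T1); rewrite -T12 TR R1E.
Qed.
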